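(* Let $k,s$ be positive integers with $s\geq 6$ and $k\geq \binom{s}{2}$. Then there exists a constant $c_2>0$ (depending only on $k$ and $s$) such that for every integer $t\geq 6$, $$\operatorname{gr}_k(s,t)>\frac{1}{\beta c_2}\left(\frac{(t-1)N^{-1/\gamma}}{\ln\left((t-1)N^{-1/\gamma}\right)}\right)^{\beta},$$ where $$\beta=\frac{\binom{s}{2}-1}{s+1},\qquad \gamma=\binom{s}{2}-1,\qquad N=\binom{s}{2}(k-1)^{2-\binom{s}{2}}(k-2)(k-3)\cdots\left(k-\binom{s}{2}+1\right).$$
   Context: A $k$-edge-coloring of $K_n$ assigns to each edge one of $k$ colors (not all colors need be used, and it need not be proper). A subgraph is rainbow if all its edges have distinct colors, and monochromatic if all its edges have the same color. The Gallai-Ramsey function $\operatorname{gr}_k(s,t)$ is the minimum integer $n$ such that every $k$-edge-coloring of the complete graph $K_n$ contains a rainbow copy of $K_s$ or a monochromatic copy of $K_t$. *)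

(* Defs.v *)
From mathcomp Require Import all_boot all_order all_algebra.
From mathcomp Require Import reals exp.

Set Implicit Arguments.
Unset Strict Implicit.
Unset Printing Implicit Defensive.

Definition edge (n : nat) := {e : {set 'I_n} | #|e| == 2}.

(* Edge-colorings of the complete graph on 'I_n; neither properness nor
   surjectivity is required. *)
Definition coloring (k n : nat) := {ffun edge n -> 'I_k}.

Section Coloring.
Variables (k n : nat) (c : coloring k n).

(* A copy of a complete graph in K_n is determined by its vertex set S. *)
Definition clique_edges (S : {set 'I_n}) : {set edge n} :=
  [set e : edge n | val e \subset S].

Definition rainbow (S : {set 'I_n}) : bool := dinjectiveb c (clique_edges S).

Definition monochromatic (S : {set 'I_n}) : bool :=
  [forall e in clique_edges S, forall f in clique_edges S, c e == c f].

End Coloring.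

(* n forces a rainbow K_s or a monochromatic K_t in every k-edge-coloring. *)
Definition gallai_ramsey (k s t n : nat) : bool :=
  [forall c : coloring k n,
     [exists S : {set 'I_n}, (#|S| == s) && rainbow c S]
  || [exists S : {set 'I_n}, (#|S| == t) && monochromatic c S]].

(* Multicolor Ramsey theorem, with one target size per color. *)
Lemma ramsey_rel (C : finType) (a : {ffun C -> nat}) :
  exists N, forall (T : finType) (c : T -> T -> C) (S : {set T}),
    (forall x y, c x y = c y x) -> N <= #|S| ->
    exists i, exists2 A : {set T}, A \subset S /\ #|A| = a i &
      {in A &, forall x y, x != y -> c x y = i}.
Proof.
have [m] := ubnP (\sum_i a i); elim: m a => // m IHm a lt_am.
have [/existsP[i /eqP ai0]|/existsPn a_neq0] := boolP [exists i, a i == 0].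
  exists 0 => T c S _ _; exists i; exists set0; first by rewrite sub0set cards0.
  by move=> x y; rewrite inE.
pose b i := [ffun j => a j - (j == i)].
have /fin_all_exists[N NP] i : exists N,
  forall (T : finType) (c : T -> T -> C) (S : {set T}),
    (forall x y, c x y = c y x) -> N <= #|S| ->
    exists j, exists2 A : {set T}, A \subset S /\ #|A| = b i j &
      {in A &, forall x y, x != y -> c x y = j}.
  apply: IHm; rewrite ltnS in lt_am; apply: leq_trans lt_am.
  rewrite (bigD1 i) //= [ltnRHS](bigD1 i) //= ffunE eqxx.
  rewrite (eq_bigr a) => [|j /negPf ji]; last by rewrite ffunE ji subn0.
  by rewrite ltn_add2r subn1 ltn_predL lt0n a_neq0.
exists (\sum_i N i).+2 => T c S cC ltNS.
have /card_gt0P[x Sx] : 0 < #|S| by apply: leq_trans ltNS.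
pose D i := [set y in S :\ x | c x y == i].
have [i leND] : exists i, N i <= #|D i|.
  apply/existsP; apply: contraLR ltNS => /existsPn ltDN.
  rewrite -leqNgt (cardsD1 x) Sx add1n ltnS.
  rewrite -sum1_card (partition_big (c x) predT) //=.
  apply: leq_sum => i _; rewrite sum1dep_card.
  by rewrite ltnW // ltnNge; apply: ltDN.
have [j [A [sAD cardA] cA]] := NP i T c (D i) cC leND.
have sAS : A \subset S.
  by apply: subset_trans sAD _; apply/subsetP=> y; rewrite !inE => /andP[/andP[]].
rewrite ffunE in cardA.
have [eq_ji|ne_ji] := eqVneq j i; last first.
  by exists j; exists A => //; rewrite cardA (negPf ne_ji) subn0.
have cxA y : y \in A -> y != x /\ c x y = i.
  by move/(subsetP sAD); rewrite !inE => /andP[/andP[? _] /eqP].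
exists i; exists (x |: A).
  split; first by rewrite subUset sub1set Sx.
  rewrite cardsU1 cardA eq_ji eqxx subn1.
  have -> : x \notin A by apply/negP=> /cxA[]; rewrite eqxx.
  by rewrite add1n prednK // lt0n a_neq0.
move=> y z; rewrite !inE => /predU1P[->|Ay] /predU1P[->|Az].
- by rewrite eqxx.
- by case: (cxA z Az).
- by rewrite cC; case: (cxA y Ay).
by move=> ne_yz; rewrite cA // eq_ji.
Qed.

Lemma gallai_ramsey_ex (k s t : nat) : exists n, gallai_ramsey k s t n.
Proof.
have [n nP] := @ramsey_rel (option 'I_k) [ffun=> t].
exists n; apply/forallP=> c; apply/orP; right.
pose d x y : option 'I_k := omap c (insub [set x; y] : option (edge n)).
have dC x y : d x y = d y x by rewrite /d setUC.
have [|i [A [_ cardA] dA]] := nP _ d [set: 'I_n] dC; first by rewrite cardsT card_ord.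
rewrite ffunE in cardA; apply/existsP; exists A; rewrite cardA eqxx /=.
have cA e : e \in clique_edges A -> Some (c e) = i.
  rewrite inE; case: e => e e2 /=; have /cards2P[x [y [ne_xy def_e]]] := e2.
  rewrite {1}def_e subUset !sub1set => /andP[Ax Ay].
  by rewrite -(dA x y) // /d -def_e insubT.
apply/forall_inP=> e Ae; apply/forall_inP=> f Af.
by apply/eqP/Some_inj; rewrite !cA.
Qed.

Definition gr (k s t : nat) : nat := ex_minn (gallai_ramsey_ex k s t).

Import GRing.Theory.
Local Open Scope ring_scope.

Section Constants.
Variable R : realType.

Definition gr_gamma (s : nat) : R := 'C(s, 2)%:R - 1.

Definition gr_beta (s : nat) : R := ('C(s, 2)%:R - 1) / (s%:R + 1).

(* The exponent 2 - 'C(s, 2) is a negative integer; the product is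
   (k - 2)(k - 3)...(k - 'C(s, 2) + 1), with subtraction in R. *)
Definition gr_N (k s : nat) : R :=
  'C(s, 2)%:R * (k%:R - 1) ^ (2 - 'C(s, 2)%:Z) *
  \prod_(2 <= j < 'C(s, 2)) (k%:R - j%:R).

End Constants.

(* Main.v *)
Require Import Defs.
From mathcomp Require Import all_boot all_order all_algebra.
From mathcomp Require Import reals exp.

(* Fewer than 'C(s, 2) colors never produce a rainbow K_s.  With j colors, label
   the vertices by distinct words of length j over an alphabet of size t - 1 and
   color an edge by a position where its two words differ: on a monochromatic
   clique the letter at that position is injective, so there is no monochromatic
   K_t.  Hence (t - 1)^j < gr_k(s, t) for j = 'C(s, 2) - 1 = gamma, which beats
   the required bound because beta <= gamma and ln x is bounded away from 0. *)

Import Order.TTheory GRing.Theory Num.Theory.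
Local Open Scope ring_scope.

Lemma card_clique_edges (n : nat) (S : {set 'I_n}) :
  #|clique_edges S| = 'C(#|S|, 2).
Proof.
rewrite -cards_draws -(card_imset _ val_inj); apply: eq_card => A.
rewrite inE; apply/imsetP/andP => [[e + ->]|[sAS A2]].
  by rewrite inE => sS; split; last exact: (valP e).
by exists (exist _ A A2); rewrite ?inE.
Qed.

(** Distinct words differ at some position; stating this as injectivity on [val e] avoids ordering
    the two endpoints. *)
Lemma edge_separation (n j b : nat) (f : 'I_n -> {ffun 'I_j -> 'I_b})
    (e : edge n) : injective f ->
  exists i, {in val e &, injective (fun x => f x i)}.
Proof.
move=> f_inj; case: e => e e2 /=; have /cards2P[x [y [ne_xy ->]]] := e2.
have [/existsP[i ne_i]|/existsPn eq_f] := boolP [exists i, f x i != f y i].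
  exists i => u v; rewrite !inE => /orP[]/eqP-> /orP[]/eqP-> // eq_i.
    by rewrite eq_i eqxx in ne_i.
  by rewrite eq_i eqxx in ne_i.
case/eqP: ne_xy; apply/f_inj/ffunP=> i.
by have := eq_f i; rewrite negbK => /eqP.
Qed.

Lemma gr_gt_expn (k s b j : nat) :
  (0 < b)%N -> (j < 'C(s, 2))%N -> (j <= k)%N -> (b ^ j < gr k s b.+1)%N.
Proof.
move=> b_gt0 lt_js le_jk; rewrite /gr; case: ex_minnP => n /forallP n_forces _.
(* If [n] were at most the number [b ^ j] of words, the vertices could carry distinct words. *)
rewrite ltnNge; apply/negP => le_n.
have le_n' : (n <= #|{: {ffun 'I_j -> 'I_b}}|)%N.
  by rewrite card_ffun !card_ord.
pose f (x : 'I_n) : {ffun 'I_j -> 'I_b} := enum_val (widen_ord le_n' x).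
have f_inj : injective f by move=> x y /enum_val_inj/(congr1 val)/= /val_inj.
have /fin_all_exists[i iP] (e : edge n) :
    exists i : 'I_j, {in val e &, injective (fun x => f x i)}.
  exact: edge_separation.
pose c : coloring k n := [ffun e => widen_ord le_jk (i e)].
have cP e1 e2 : c e1 = c e2 -> i e1 = i e2.
  by rewrite !ffunE => /(congr1 val)/= /val_inj.
have /orP[] := n_forces c => /existsP[S /andP[/eqP cardS]].
  move=> /dinjectiveP cS.
  have /card_in_imset cardi : {in clique_edges S &, injective i}.
    by move=> e1 e2 e1S e2S eq_i; apply: cS => //; rewrite !ffunE eq_i.
  have := max_card [in i @: clique_edges S].
  by rewrite cardi card_clique_edges cardS card_ord leqNgt lt_js.
move=> /forall_inP mono.
have sep x y : x \in S -> y \in S -> x != y ->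
    exists2 e, e \in clique_edges S & val e = [set x; y].
  move=> xS yS ne_xy; have e2 : #|[set x; y]| == 2 by rewrite cards2 ne_xy.
  by exists (exist _ [set x; y] e2); rewrite ?inE //= subUset !sub1set xS.
(* Since [b > 0], the clique has an edge [e0]. All its edges share the color of [e0], so the single
   position [i e0] separates every pair, giving [b.+1] distinct letters. *)
have /card_gt1P[x0 [y0 [x0S y0S ne0]]] : (1 < #|S|)%N by rewrite cardS.
have [e0 e0S _] := sep _ _ x0S y0S ne0.
have /card_in_imset cardf : {in S &, injective (fun x => f x (i e0))}.
  move=> x y xS yS /eqP; apply: contraTeq => ne_xy.
  have [e eS def_e] := sep _ _ xS yS ne_xy.
  have /cP <- := eqP (forall_inP (mono e eS) e0 e0S).
  apply: contra ne_xy => /eqP eq_f; apply/eqP.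
  by apply: (iP e) => //; rewrite def_e !inE eqxx ?orbT.
have := max_card [in (fun x => f x (i e0)) @: S].
by rewrite cardf cardS card_ord ltnn.
Qed.

Lemma gr_N_gt0 (R : realType) (k s : nat) :
  (2 <= 'C(s, 2) <= k)%N -> 0 < gr_N R k s.
Proof.
case/andP=> C_ge2 hk; have k_gt1 : (1 < k)%N := leq_trans C_ge2 hk.
rewrite /gr_N !mulr_gt0 //.
- by rewrite ltr0n ltnW.
- by rewrite exprz_gt0 // subr_gt0 ltr1n.
rewrite big_nat; apply: prodr_gt0 => j /andP[_ ltj].
by rewrite subr_gt0 ltr_nat (leq_trans ltj).
Qed.

(** The product has 'C(s, 2) - 2 factors, each at most [k - 1], so the negative power of [k - 1]
    outweighs it. *)
Lemma gr_N_le (R : realType) (k s : nat) :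
  (2 <= 'C(s, 2) <= k)%N -> gr_N R k s <= 'C(s, 2)%:R.
Proof.
case/andP=> C_ge2 hk; have k_gt1 : (1 < k)%N := leq_trans C_ge2 hk.
have k1_gt0 : 0 < k%:R - 1 :> R by rewrite subr_gt0 ltr1n.
rewrite /gr_N -mulrA ler_piMr //.
have -> : 2 - 'C(s, 2)%:Z = - ('C(s, 2) - 2)%N%:Z by rewrite -subzn // opprB.
rewrite -invr_expz mulrC ler_pdivrMr ?exprz_gt0 // mul1r -exprnP.
rewrite -prodr_const_nat !big_nat; apply: ler_prod => j /andP[lej ltj].
rewrite subr_ge0 ler_nat lerD2l lerN2 ler1n.
by rewrite (leq_trans _ lej) // (leq_trans (ltnW ltj)).
Qed.

Theorem theorem3p3 (R : realType) (k s : nat)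
    (hs : (6 <= s)%N) (hk : ('C(s, 2) <= k)%N) :
  exists c2 : R, 0 < c2 /\
    forall t : nat, (6 <= t)%N ->
      let beta := gr_beta R s in
      let x := (t%:R - 1) * gr_N R k s `^ (- (1 / gr_gamma R s)) in
      (gr k s t)%:R > 1 / (beta * c2) * (x / ln x) `^ beta.
Proof.
have C_gt1 : (1 < 'C(s, 2))%N by apply: leq_trans (leq_bin2l 2 hs).
have Cp_gt0 : (0 < 'C(s, 2).-1)%N by rewrite -subn1 subn_gt0.
have hC : (2 <= 'C(s, 2) <= k)%N by rewrite C_gt1.
have gammaE : gr_gamma R s = ('C(s, 2).-1)%:R.
  by rewrite /gr_gamma -[in LHS](prednK (ltnW C_gt1)) -natr1 addrK.
have gamma_gt0 : 0 < gr_gamma R s by rewrite subr_gt0 ltr1n.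
have beta_gt0 : 0 < gr_beta R s.
  by rewrite divr_gt0 // addr_gt0 // ltr0n (leq_trans _ hs).
have beta_le : gr_beta R s <= gr_gamma R s.
  by rewrite ler_pdivrMr ?ltr_wpDl // ler_peMr ?(ltW gamma_gt0) // lerDr.
set beta := gr_beta R s in beta_gt0 beta_le *.
have N_gt0 := gr_N_gt0 R k s hC.
set nu := gr_N R k s `^ (- (1 / gr_gamma R s)).
have nu_gt0 : 0 < nu by rewrite powR_gt0.
(* N <= 'C(s, 2) < 5 ^ gamma *)
have lt1_5nu : 1 < 5 * nu.
  rewrite /nu powRN -ltr_pdivrMr ?invr_gt0 ?powR_gt0 // !mul1r invrK.
  rewrite -(@ltr_pXn2r _ 'C(s, 2).-1) ?nnegrE ?powR_ge0 //.
  rewrite -powR_mulrn ?powR_ge0 // -powRrM gammaE mulVf -?gammaE ?gt_eqF //.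
  rewrite powRr1 ?(ltW N_gt0) //; apply: le_lt_trans (gr_N_le R k s hC) _.
  rewrite -natrX ltr_nat -[ltnLHS](prednK (ltnW C_gt1)).
  (* With m = 'C(s, 2) - 1 > 0, this is m + 1 <= 2 ^ m < 5 ^ m. *)
  apply: leq_ltn_trans (ltn_expl _ (isT : 1 < 2)%N) _.
  by rewrite ltn_exp2r.
(* As [t >= 6] gives [x >= 5 * nu], [d] is a positive lower bound for [ln x], uniform in [t]. *)
set d := ln (5 * nu); have d_gt0 : 0 < d by rewrite ln_gt0.
(* Chosen so that [beta * c2 = (nu / d) ^ beta]. From [x / ln x <= (t - 1) * (nu / d)], the claimed
   bound is then at most [(t - 1) ^ beta]. *)
exists ((nu / d) `^ beta / beta); split.
  by rewrite divr_gt0 // powR_gt0 ?divr_gt0.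
move=> t t6 /=; set x := _ * nu.
have t1_ge5 : 5 <= t%:R - 1 :> R by rewrite lerBrDr natr1 ler_nat.
have t1_gt0 : 0 < t%:R - 1 :> R by rewrite (lt_le_trans _ t1_ge5).
have x_ge : 5 * nu <= x by rewrite ler_pM2r.
have x_gt0 : 0 < x by rewrite mulr_gt0.
have le_d : d <= ln x by rewrite ler_ln ?posrE // mulr_gt0.
have nud_gt0 : 0 < (nu / d) `^ beta by rewrite powR_gt0 ?divr_gt0.
rewrite mulrCA divff ?gt_eqF // mulr1 mul1r mulrC ltr_pdivrMr //.
apply: (@le_lt_trans _ _ ((t%:R - 1) `^ gr_gamma R s * (nu / d) `^ beta)).
  apply: (@le_trans _ _ ((t%:R - 1) `^ beta * (nu / d) `^ beta)).
    rewrite -powRM; [|exact: ltW|exact/ltW/divr_gt0].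
    apply: ge0_ler_powR; rewrite ?nnegrE; first exact: ltW.
    - by rewrite ltW // divr_gt0 // (lt_le_trans d_gt0).
    - by rewrite ltW // mulr_gt0 // divr_gt0.
    by rewrite mulrA ler_pM2l // lef_pV2 ?posrE // (lt_le_trans d_gt0).
  (* Raising the exponent from [beta] to [gamma] is harmless because [t - 1 >= 1]. *)
  by rewrite ler_pM2r // ler_powR // (le_trans _ t1_ge5) // ler1n.
rewrite ltr_pM2r // gammaE powR_mulrn ?ltW //.
have t_gt0 : (0 < t)%N by apply: leq_trans t6.
rewrite -{1}(prednK t_gt0) -natr1 addrK -natrX ltr_nat -{2}(prednK t_gt0).
apply: gr_gt_expn.
- by rewrite -subn1 subn_gt0 (leq_trans _ t6).
- by rewrite ltn_predL ltnW.
- exact: leq_trans (leq_pred _) hk.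
Qed.
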